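(* Let $\phi,G:(0,\infty)\to[0,\infty)$ be measurable functions with $\int_0^\infty G(x)\phi(x)\,dx=1$. Suppose that for some constants $K,M>0$ and $R>1$ and some function $\zeta:(R,\infty)\to[1,\infty)$: $$0\le G(x)\le K\quad(x>0),$$ $$\int_{Rx}^\infty G(y)\phi(y)\,dy\le K\,G(x)\quad(x>M),$$ $$\frac1{\zeta(y)}\phi(y)\le K\,\phi(z)\quad(\max\{2RM,Rz\}<y<2Rz).$$ Assume also that the fragmentation coefficient $b$ satisfies, for the same constants $K,M,R$, $$G(x)\,\phi(y)\le K\,b(y,x)\quad(0<x<y<\max\{2Rx,2RM\}),$$ $$\zeta(y)\,y^{-1}\le K\,b(y,x)\quad(y>M,\ y>x>0).$$ Then there is some constant $C>0$ such that $$H_2[g|G]\le C\,D^b[g|G]$$ for all measurable functions $g:(0,\infty)\to[0,\infty)$ such that $\int_0^\infty g\,\phi\,dx=1$ (in the sense that if the right-hand side is finite, then the left-hand side is also, and the inequality holds).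
   Context: The fragmentation coefficient is a nonnegative measurable function $b(y,x)$ defined for $y>x>0$. For measurable $g$ write $u(x):=g(x)/G(x)$. Then $$H_2[g|G]:=\int_0^\infty\phi(x)\,G(x)\,(u(x)-1)^2\,dx,$$ $$D^b[g|G]:=\int_0^\infty\int_x^\infty\phi(x)\,G(y)\,b(y,x)\,(u(x)-u(y))^2\,dy\,dx.$$ The constant $C$ does not depend on $g$.
   Formalization: Since G may vanish, u = g/G can be undefined and the claim fails; it is assumed that gφ = 0 for almost every x with G(x) = 0 (and 0/0 is read as 0). If M < R, ζ is also taken to be defined with values ≥ 1 on (M, R], where the hypotheses evaluate it. *)

(* Defs.v *)
From HB Require Import structures.
From mathcomp Require Import all_boot all_order all_algebra.
From mathcomp Require Import all_classical all_reals all_analysis.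

Set Implicit Arguments.
Unset Strict Implicit.
Unset Printing Implicit Defensive.

Import Order.TTheory GRing.Theory Num.Theory.
Import numFieldNormedType.Exports.

Local Open Scope classical_set_scope.
Local Open Scope ring_scope.

(* Functions on (0, +oo) are total functions R -> R, of which only the values
   on the positive half-line matter; likewise only the values b y x with
   0 < x < y of the fragmentation coefficient matter. *)

(* Where G vanishes this is 0, as x / 0 = 0. *)
Definition reldens (R : realType) (g G : R -> R) (x : R) : R := g x / G x.

Definition H2 (R : realType) (phi g G : R -> R) : \bar R :=
  (\int[@lebesgue_measure R]_(x in `]0%R, +oo[)
     (phi x * G x * (reldens g G x - 1) ^+ 2)%:E)%E.

Definition Db (R : realType) (phi : R -> R) (b : R -> R -> R) (g G : R -> R) :
    \bar R :=
  (\int[@lebesgue_measure R]_(x in `]0%R, +oo[)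
     \int[@lebesgue_measure R]_(y in `]x, +oo[)
       (phi x * G y * b y x * (reldens g G x - reldens g G y) ^+ 2)%:E)%E.

(* g phi dx is absolutely continuous with respect to G dx on (0, +oo): up to a
   null set for phi dx, the ratio g / G is never of the form c / 0 with c > 0.
   Automatic when G > 0. *)
Definition reldens_defined (R : realType) (phi g G : R -> R) : Prop :=
  {ae @lebesgue_measure R, forall x, 0 < x -> G x = 0 -> g x * phi x = 0}.

(* Main.v *)
(* Write u = g/G and let nu be the probability measure G phi dx. As u has mean
   1 under nu, (u(x) - 1)^2 is at most the nu-mean in y of (u(x) - u(y))^2, so
   H2 is bounded by twice the integral of (u(x) - u(y))^2 over nu x nu
   restricted to x < y. Pairs with y < max(2rx, 2rM) are controlled directly
   by the lower bound on b. For the other pairs, insert an intermediate point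
   z, averaged uniformly over (y/2r, y/r), and split (u(x) - u(y))^2 into
   2(u(x) - u(z))^2 + 2(u(z) - u(y))^2. In the first term y is integrated out
   by the tail bound on G phi, in the second x is integrated out by nu = 1;
   what remains is dominated by the dissipation, since b(y,x) is at least of
   order zeta(y)/y. *)
Require Import Defs.
From HB Require Import structures.
From mathcomp Require Import all_boot all_order all_algebra.
From mathcomp Require Import all_classical all_reals all_analysis.
From mathcomp Require Import measurable_realfun.
From mathcomp Require Import ring lra.

Set Implicit Arguments.
Unset Strict Implicit.
Unset Printing Implicit Defensive.

Import Order.TTheory GRing.Theory Num.Theory.
Import numFieldNormedType.Exports.

Local Open Scope classical_set_scope.
Local Open Scope ring_scope.

(** * Measurability and nonnegativity of explicit expressions *)

(** The identity 1/x = x (1/|x|)^2 reduces this to the real power function; at x = 0 both sides are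
    0. *)
Lemma measurable_invr (R : realType) : measurable_fun setT (fun x : R => x^-1).
Proof.
rewrite (_ : (fun x : R => _) = fun x => x * (`|x| `^ (-1)) ^+ 2); last first.
  apply/funext => x; rewrite powR_inv1// exprVn.
  have [->|x0] := eqVneq x 0; first by rewrite mul0r invr0.
  by rewrite real_normK ?num_real// expr2 invfM mulrA mulfV// mul1r.
apply: measurable_funM; first exact: measurable_id.
apply: measurable_funX.
have mP : measurable_fun setT (fun x : R => x `^ (-1)) by exact: measurable_powR.
have mN : measurable_fun setT (fun x : R => `|x|) by exact: normr_measurable.
exact: (measurableT_comp mP mN).
Qed.

Ltac prove_measurable :=
  repeat lazymatch goal with
    | H : measurable_fun _ ?f |- measurable_fun _ ?f => exact: H
    | |- measurable_fun _ (fun x => (@?f x)%:E) => apply/measurable_EFinP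
    | |- measurable_fun _ (fun x => if @?c x then _ else _) =>
        apply: measurable_fun_ifT
    | |- measurable_fun _ (fun x => @?f x && @?g x) => apply: measurable_and
    | |- measurable_fun _ (fun x => (@?f x < @?g x)%R) =>
        apply: measurable_fun_ltr
    | |- measurable_fun _ (fun x => (@?f x <= @?g x)%R) =>
        apply: measurable_fun_ler
    | |- measurable_fun _ (@Order.lt _ _ _) => apply: measurable_fun_ltr
    | |- measurable_fun _ (@Order.le _ _ _) => apply: measurable_fun_ler
    | |- measurable_fun _ (fun x => @?f x ^+ 2) => apply: measurable_funX
    | |- measurable_fun _ (fun x => @?f x - @?g x) => apply: measurable_funB
    | |- measurable_fun _ (fun x => @?f x + @?g x) => apply: measurable_funD
    | |- measurable_fun _ (fun x => @?f x * @?g x) => apply: measurable_funM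
    | |- measurable_fun _ (fun x => x) => exact: measurable_id
    | |- measurable_fun _ (fun x => x.1) => exact: measurable_fst
    | |- measurable_fun _ (fun x => x.2) => exact: measurable_snd
    | |- measurable_fun _ (fun x => (@?f x)^-1) =>
        apply: (measurableT_comp (@measurable_invr _))
    | |- measurable_fun _ (fun x => ?f (@?g x)) =>
        match goal with
        | H : measurable_fun _ f |- _ =>
            first [exact: H | apply: (measurableT_comp H)]
        | _ => exact: measurable_cst
        end
    | |- measurable_fun _ _ => exact: measurable_cst
    end.

Ltac prove_ge0 :=
  repeat lazymatch goal with
    | |- is_true (0 <= _ ^+ 2) => exact: sqr_ge0
    | |- is_true (0 <= _ ^+ _) => apply: exprn_ge0
    | |- is_true (0 <= _ * _) => apply: mulr_ge0
    | |- is_true (0 <= _ + _) => apply: addr_ge0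
    | |- is_true (0 <= _^-1) => rewrite invr_ge0
    | |- is_true (0 <= (if _ then _ else _)) => case: ifP => // _
    | |- is_true (0 <= _) => first [done | by apply: ltW]
    end.

(** * Mean inequality, symmetrisation and averaging interval *)

(** Jensen's inequality for the square. Integrating a^2 w + 2 w u <= w (a - u)^2 + 2 a w u + w and
    using that mass and mean are 1 gives a^2 + 2 <= I + 2 a + 1, with I the integral on the right of
    the claim. *)
Lemma sqr_dist_mean_le d (T : measurableType d) (R : realType)
    (m : {measure set T -> \bar R}) (w u : T -> R) (a : R) :
  measurable_fun setT w -> measurable_fun setT u ->
  (forall x, 0 <= w x) -> (forall x, 0 <= u x) -> 0 <= a ->
  (\int[m]_x (w x)%:E = 1)%E -> (\int[m]_x (w x * u x)%:E = 1)%E ->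
  (((a - 1) ^+ 2)%:E <= \int[m]_x (w x * (a - u x) ^+ 2)%:E)%E.
Proof.
move=> mw mu w0 u0 a0 w1 wu1.
have wu0 x : 0 <= w x * u x by rewrite mulr_ge0.
have wuE x : setT x -> (0 <= (w x * u x)%:E)%E by rewrite lee_fin.
(* The two integrands differ by w (u - 1)^2; both are nonnegative, so that no
   integrability is needed. *)
have L : (\int[m]_x ((a ^+ 2)%:E * (w x)%:E + 2%:E * (w x * u x)%:E)
    <= \int[m]_x ((w x * (a - u x) ^+ 2)%:E +
         ((a *+ 2)%:E * (w x * u x)%:E + (w x)%:E)))%E.
  apply: ge0_le_integral => //.
  - by move=> x _; rewrite lee_fin addr_ge0 ?mulr_ge0 ?sqr_ge0.
  - by apply/measurable_EFinP; prove_measurable.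
  - by apply/measurable_EFinP; prove_measurable.
  - move=> x _; rewrite lee_fin.
    have := mulr_ge0 (w0 x) (sqr_ge0 (u x - 1)); nra.
move: L; rewrite ge0_integralD//; last 4 first.
- by move=> x _; rewrite lee_fin mulr_ge0 ?sqr_ge0.
- by apply/measurable_EFinP; prove_measurable.
- by move=> x _; rewrite lee_fin mulr_ge0.
- by apply/measurable_EFinP; prove_measurable.
rewrite ge0_integralZl_EFin ?sqr_ge0//; last 2 first.
- by move=> x _; rewrite lee_fin.
- by prove_measurable.
rewrite ge0_integralZl_EFin//; last by prove_measurable.
rewrite [leRHS]ge0_integralD//; last 4 first.
- by move=> x _; rewrite lee_fin mulr_ge0 ?sqr_ge0.
- by prove_measurable.
- by move=> x _; rewrite lee_fin addr_ge0// mulr_ge0// mulrn_wge0.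
- by apply/measurable_EFinP; prove_measurable.
rewrite [in leRHS]ge0_integralD//; last 4 first.
- by move=> x _; rewrite lee_fin mulr_ge0// mulrn_wge0.
- by apply/measurable_EFinP; prove_measurable.
- by move=> x _; rewrite lee_fin.
- by prove_measurable.
rewrite ge0_integralZl_EFin ?mulrn_wge0//; last by prove_measurable.
rewrite w1 wu1 !mule1 -!EFinD.
(* Only a finite integral needs the arithmetic; an infinite one makes the bound trivial. *)
by case: (integral _ _ _) => [s| |]//; rewrite -?EFinD ?lee_fin ?leey//; lra.
Qed.

(** Pointwise, [F] is at most its restriction to [c] plus its restriction to the transpose of [c].
    By Tonelli and the symmetry of [F], both restrictions have the same double integral. *)
Lemma le_integral_sym d (T : measurableType d) (R : realType)
    (m : {sigma_finite_measure set T -> \bar R}) (c : T -> T -> bool)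
    (F : T -> T -> R) :
  measurable_fun setT (fun z : T * T => c z.1 z.2) ->
  measurable_fun setT (fun z : T * T => F z.1 z.2) ->
  (forall x y, 0 <= F x y) -> (forall x y, F x y = F y x) ->
  (forall x y, ~~ c x y -> ~~ c y x -> F x y = 0) ->
  (\int[m]_x \int[m]_y (F x y)%:E <=
   2%:E * \int[m]_x \int[m]_y (if c x y then F x y else 0)%:E)%E.
Proof.
move=> mc mF F0 Fsym Fc.
pose f (z : T * T) : \bar R := (if c z.1 z.2 then F z.1 z.2 else 0)%:E.
pose h (z : T * T) : \bar R := (if c z.2 z.1 then F z.1 z.2 else 0)%:E.
have mf : measurable_fun setT f by rewrite /f; prove_measurable.
have mh : measurable_fun setT h.
  rewrite (_ : h = f \o unstable.swap); last first.
    by apply/funext => -[x y]; rewrite /h/f/= Fsym.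
  by apply: measurableT_comp => //; exact: measurable_swap.
have f0 z : (0 <= f z)%E by rewrite /f lee_fin; case: ifP.
have h0 z : (0 <= h z)%E by rewrite /h lee_fin; case: ifP.
have mf1 x : measurable_fun setT (fun y => f (x, y)) by exact: measurableT_comp.
have mh1 x : measurable_fun setT (fun y => h (x, y)) by exact: measurableT_comp.
apply: (@le_trans _ _ (\int[m]_x (\int[m]_y f (x, y) + \int[m]_y h (x, y))))%E.
  have mG : measurable_fun setT (fun x => \int[m]_y (F x y)%:E)%E.
    apply: (@measurable_fun_fubini_tonelli_F _ _ _ _ _ m (fun z => (F z.1 z.2)%:E)).
      by prove_measurable.
    by move=> z; rewrite lee_fin.
  apply: ge0_le_integral => //.
  - by move=> x _; apply: integral_ge0 => y _; rewrite lee_fin.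
  - apply: emeasurable_funD.
    + exact: (@measurable_fun_fubini_tonelli_F _ _ _ _ _ m f).
    + exact: (@measurable_fun_fubini_tonelli_F _ _ _ _ _ m h).
  move=> x _; rewrite -ge0_integralD//.
  apply: ge0_le_integral => //.
  - by move=> y _; rewrite lee_fin.
  - by apply/measurable_EFinP; exact: (measurableT_comp mF (pair1_measurable x)).
  - exact: emeasurable_funD.
  - move=> y _; rewrite /f/h/= -EFinD lee_fin.
    have := F0 x y; case: ifP => c1; case: ifP => c2; try lra.
    by rewrite Fc ?c1 ?c2// addr0.
rewrite ge0_integralD//; last 4 first.
- by move=> x _; apply: integral_ge0.
- exact: (@measurable_fun_fubini_tonelli_F _ _ _ _ _ m f).
- by move=> x _; apply: integral_ge0.
- exact: (@measurable_fun_fubini_tonelli_F _ _ _ _ _ m h).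
rewrite [X in (_ + X)%E](fubini_tonelli h)//.
rewrite (_ : (\int[m]_y \int[m]_x h (x, y) = \int[m]_x \int[m]_y f (x, y))%E); last first.
  by apply: eq_integral => x _; apply: eq_integral => y _; rewrite /h/f/= Fsym.
by rewrite -mule2n mule_natl.
Qed.

(** The condition on z describes the interval (y/2r, y/r), of length y/2r. Averaging over it
    therefore costs the factor 2r/y. *)
Lemma integral_indicator_lt_gt (R : realType) (r y c : R) :
  1 < r -> 0 < y -> 0 <= c ->
  (\int[@lebesgue_measure R]_z
     (if (y < 2 * r * z) && (r * z < y) then c else 0)%:E
   = (c * (y / (2 * r)))%:E)%E.
Proof.
move=> r1 y0 c0; have r0 : 0 < r by lra.
pose A := [set` `]y / (2 * r), y / r[].
have mA : measurable A by exact: measurable_itv.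
have lA : lebesgue_measure A = (y / (2 * r))%:E.
  rewrite /A lebesgue_measure_itv/= lte_fin ifT.
    by rewrite -EFinB; congr (_%:E); field; rewrite gt_eqF.
  by rewrite ltr_pM2l// ltf_pV2 ?posrE ?mulr_gt0//; lra.
rewrite (_ : (fun z => _) = (fun z => c%:E * (\1_A z)%:E)%E); last first.
  apply/funext => z; rewrite indicE /A mem_setE in_itv/=.
  rewrite ltr_pdivrMr ?mulr_gt0// ltr_pdivlMr// [z * (2 * r)]mulrC [z * r]mulrC.
  by case: ifP => _; rewrite ?mule1 ?mule0.
rewrite ge0_integralZl_EFin//; last first.
  by apply/measurable_EFinP; exact: measurable_indic.
by rewrite integral_indic// setIT EFinM -lA.
Qed.

(** * The inequality for functions on the whole line *)

(* p, q and u stand for phi, G and g/G extended by 0 to the whole line; near_le,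
   far_le and mid_le are what is used of the hypotheses on b, with zeta
   eliminated. *)
Section entropy_dissipation.
Variables (R : realType) (p q u : R -> R) (b : R -> R -> R) (K M r : R).
Hypotheses (p_meas : measurable_fun setT p) (q_meas : measurable_fun setT q)
  (u_meas : measurable_fun setT u)
  (b_meas : measurable_fun setT
    (fun z : measurableTypeR R * measurableTypeR R => b z.1 z.2)).
Hypotheses (p_ge0 : forall x, 0 <= p x) (q_ge0 : forall x, 0 <= q x)
  (b_ge0 : forall y x, 0 <= b y x).
Hypotheses (K_gt0 : 0 < K) (M_gt0 : 0 < M) (r_gt1 : 1 < r).
Hypothesis p_eq0 : forall x, x <= 0 -> p x = 0.
Hypothesis qp_eq1 : (\int[@lebesgue_measure R]_x (q x * p x)%:E = 1)%E.
Hypothesis q_le : forall x, q x <= K.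
Hypothesis tail_le : forall x, M < x ->
  (\int[@lebesgue_measure R]_y (if r * x < y then q y * p y else 0)%:E
     <= (K * q x)%:E)%E.
Hypothesis near_le : forall x y, 0 < x -> x < y ->
  (y < 2 * r * x) || (y < 2 * r * M) -> q x * p y <= K * b y x.
Hypothesis far_le : forall x y, M < y -> 0 < x < y -> y^-1 <= K * b y x.
Hypothesis mid_le : forall y z, 0 < z -> 2 * r * M < y -> r * z < y < 2 * r * z ->
  y^-1 * p y <= K ^+ 2 * (p z * b y z).

Local Notation mu := (@lebesgue_measure R).

(** [diss] is the integrand of the dissipation and [ent] is the density of (u(x) - u(y))^2 under nu
    x nu. [diss] is integrated over the whole plane, as [b] will be extended by 0 outside 0 < x <
    y. *)
Local Notation diss x y := (p x * q y * b y x * (u x - u y) ^+ 2).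
Local Notation ent x y := (p x * q x * (p y * q y) * (u x - u y) ^+ 2).

Let r_gt0 : 0 < r. Proof. exact: lt_trans r_gt1. Qed.

Let diss_ge0 x y : 0 <= diss x y.
Proof. by prove_ge0. Qed.

Let ent_ge0 x y : 0 <= ent x y.
Proof. by prove_ge0. Qed.

Let Mpos y : 2 * r * M < y -> 0 < y.
Proof. by apply: lt_trans; rewrite !mulr_gt0. Qed.

Let diss_meas : measurable_fun setT
  (fun z : measurableTypeR R * measurableTypeR R => (diss z.1 z.2)%:E).
Proof.
(* [b] takes the larger argument first, whereas [diss] takes the smaller one first. *)
have bs : measurable_fun setT
    (fun z : measurableTypeR R * measurableTypeR R => b z.2 z.1).
  have -> : (fun z : measurableTypeR R * measurableTypeR R => b z.2 z.1) =
    (fun z : measurableTypeR R * measurableTypeR R => b z.1 z.2) \o unstable.swap by [].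
  by apply: measurableT_comp => //; exact: measurable_swap.
by prove_measurable.
Qed.

Let diss_meas1 x : measurable_fun setT (fun y => (diss x y)%:E).
Proof. exact: (measurableT_comp diss_meas (pair1_measurable x)). Qed.

Let dissE_ge0 x y : (0 <= (diss x y)%:E)%E.
Proof. by rewrite lee_fin. Qed.

Let dissI_ge0 x : (0 <= \int[mu]_y (diss x y)%:E)%E.
Proof. exact: integral_ge0. Qed.

Let dissI_meas : measurable_fun setT (fun x => \int[mu]_y (diss x y)%:E)%E.
Proof.
exact: (@measurable_fun_fubini_tonelli_F _ _ _ _ _ mu (fun z => (diss z.1 z.2)%:E)).
Qed.

(** * Far pairs, through an intermediate point *)

(** This is the (u(z) - u(y))^2 half of the splitting, without its x-dependent weight. The point z
    takes the place of the smaller argument of the dissipation, and [mid_le] trades y^-1 p(y) for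
    K^2 p(z) b(y, z). *)
Lemma le_integral_mid :
  (\int[mu]_y \int[mu]_z (if [&& 2 * r * M < y, y < 2 * r * z & r * z < y] then
      y^-1 * (p y * q y) * (u z - u y) ^+ 2 else 0)%:E
   <= (K ^+ 2)%:E * \int[mu]_x \int[mu]_y (diss x y)%:E)%E.
Proof.
pose f (w : measurableTypeR R * measurableTypeR R) : \bar R :=
  (if [&& 2 * r * M < w.1, w.1 < 2 * r * w.2 & r * w.2 < w.1] then
      w.1^-1 * (p w.1 * q w.1) * (u w.2 - u w.1) ^+ 2 else 0)%:E.
have mf : measurable_fun setT f by rewrite /f; prove_measurable.
have f0 w : (0 <= f w)%E.
  rewrite /f lee_fin; case: ifP => // /andP[w1 _].
  by have ? := Mpos w1; prove_ge0.
rewrite [leLHS](fubini_tonelli f)// -ge0_integralZl_EFin ?sqr_ge0//.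
apply: ge0_le_integral => //.
- by move=> x _; apply: integral_ge0.
- exact: (@measurable_fun_fubini_tonelli_G _ _ _ _ _ mu f).
- exact: measurable_funeM.
move=> z _; rewrite -ge0_integralZl_EFin ?sqr_ge0//; last exact: diss_meas1.
apply: ge0_le_integral => //.
- exact: (measurableT_comp mf (pair2_measurable z)).
- by apply: measurable_funeM; exact: diss_meas1.
move=> y _; rewrite -EFinM lee_fin; case: ifP => [|_]; last by prove_ge0.
move=> /and3P[/= My yz zy].
have y0 := Mpos My.
have z0 : 0 < z.
  by have := lt_trans y0 yz; rewrite pmulr_rgt0// mulr_gt0.
rewrite [leLHS](_ : _ = y^-1 * p y * (q y * (u z - u y) ^+ 2)); last by ring.
rewrite [leRHS](_ : _ =
  K ^+ 2 * (p z * b y z) * (q y * (u z - u y) ^+ 2)); last by ring.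
by apply: ler_wpM2r; [prove_ge0|rewrite mid_le// zy yz].
Qed.

(** This is the (u(x) - u(z))^2 half. For fixed z, y^-1 is at most z^-1 and y is integrated out by
    [tail_le] at z, leaving a multiple of q(z); then [far_le] at (x, z) turns z^-1 into b(z, x),
    which yields the dissipation of the pair (x, z). *)
Lemma le_integral_tail x :
  (\int[mu]_y \int[mu]_z
     (if [&& 2 * r * M < y, 2 * r * x <= y, y < 2 * r * z & r * z < y] then
        y^-1 * (p x * q x) * (p y * q y) * (u x - u z) ^+ 2 else 0)%:E
   <= (K ^+ 3)%:E * \int[mu]_y (diss x y)%:E)%E.
Proof.
pose f (w : measurableTypeR R * measurableTypeR R) : \bar R :=
  (if [&& 2 * r * M < w.1, 2 * r * x <= w.1, w.1 < 2 * r * w.2 & r * w.2 < w.1]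
   then w.1^-1 * (p x * q x) * (p w.1 * q w.1) * (u x - u w.2) ^+ 2 else 0)%:E.
have mf : measurable_fun setT f by rewrite /f; prove_measurable.
have f0 w : (0 <= f w)%E.
  rewrite /f lee_fin; case: ifP => // /andP[w1 _].
  by have ? := Mpos w1; prove_ge0.
have K3 : 0 <= K ^+ 3 by rewrite exprn_ge0// ltW.
rewrite [leLHS](fubini_tonelli f)// -ge0_integralZl_EFin//; last exact: diss_meas1.
apply: ge0_le_integral => //.
- by move=> z _; apply: integral_ge0.
- exact: (@measurable_fun_fubini_tonelli_G _ _ _ _ _ mu f).
- by apply: measurable_funeM; exact: diss_meas1.
move=> z _; rewrite -EFinM.
have rhs0 : 0 <= K ^+ 3 * diss x z by rewrite mulr_ge0.
have [x0|x0] := leP x 0.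
  rewrite integral0_eq ?lee_fin// => y _.
  by rewrite /f/= p_eq0// mul0r mulr0 !mul0r if_same.
(* The conditions on y force both inequalities: 2rM < y < 2rz gives M < z, and 2rx <= y < 2rz gives
   x < z. Otherwise the inner integral is 0. *)
have [|/negP Mxz] := boolP ((M < z) && (x < z)); last first.
  rewrite integral0_eq ?lee_fin// => y _.
  rewrite /f/=; case: ifP => // /and4P[My xy yz _]; exfalso; apply: Mxz.
  have r20 : 0 < 2 * r by rewrite mulr_gt0.
  rewrite -(ltr_pM2l r20) (lt_trans My yz)/=.
  by rewrite -(ltr_pM2l r20) (le_lt_trans xy yz).
move=> /andP[Mz xz]; have z0 : 0 < z by exact: lt_trans Mz.
set c := z^-1 * (p x * q x) * (u x - u z) ^+ 2.
have c0 : 0 <= c by rewrite /c; prove_ge0.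
apply: (@le_trans _ _ (\int[mu]_y
    (c%:E * (if r * z < y then q y * p y else 0)%:E))%E).
  apply: ge0_le_integral => //.
  - exact: (measurableT_comp mf (pair2_measurable z)).
  - by apply/measurable_EFinP; prove_measurable.
  move=> y _; rewrite -EFinM lee_fin.
  case: ifP => [/and4P[/= My xy yz zy]|_]; last first.
    by rewrite mulr_ge0//; case: ifP => // _; rewrite mulr_ge0.
  rewrite zy /c [q y * _]mulrC.
  rewrite [leLHS](_ : _ =
    y^-1 * (p x * q x * (u x - u z) ^+ 2 * (p y * q y))); last by ring.
  rewrite [leRHS](_ : _ =
    z^-1 * (p x * q x * (u x - u z) ^+ 2 * (p y * q y))); last by ring.
  apply: ler_wpM2r; first by prove_ge0.
  (* Since r > 1, z <= r z < y. *)
  rewrite lef_pV2 ?posrE ?(Mpos My)//.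
  by rewrite (le_trans _ (ltW zy))// ler_peMl ?ltW.
rewrite ge0_integralZl_EFin//; last 2 first.
- by move=> y _; rewrite lee_fin; case: ifP => // _; rewrite mulr_ge0.
- by prove_measurable.
apply: le_trans (lee_wpmul2l _ (tail_le Mz)) _; first by rewrite lee_fin.
rewrite -EFinM lee_fin /c.
(* The power K^3 collects one K from [tail_le], one from [far_le] and one from q(x) <= K. *)
have h1 : z^-1 * q x <= K * b z x * K.
  by rewrite ler_pM ?invr_ge0 ?(ltW z0)// far_le// x0 xz.
rewrite [leLHS](_ : _ =
  (z^-1 * q x) * (p x * (K * q z) * (u x - u z) ^+ 2)); last by ring.
rewrite [leRHS](_ : _ =
  (K * b z x * K) * (p x * (K * q z) * (u x - u z) ^+ 2)); last by ring.
by apply: ler_wpM2r => //; prove_ge0.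
Qed.

(** The factor 4r is 2, from splitting the square, times 2r, from the normalisation 2r/y of the
    average over z. The second term keeps the weight p(x) q(x), which has total mass 1 once x is
    integrated. *)
Lemma le_integral_far x :
  (\int[mu]_y (if (2 * r * M < y) && (2 * r * x <= y) then ent x y else 0)%:E
   <= (4 * r)%:E * ((K ^+ 3)%:E * \int[mu]_y (diss x y)%:E +
       (p x * q x)%:E * ((K ^+ 2)%:E * \int[mu]_s \int[mu]_y (diss s y)%:E)))%E.
Proof.
pose f (w : measurableTypeR R * measurableTypeR R) : \bar R :=
  (if [&& 2 * r * M < w.1, 2 * r * x <= w.1, w.1 < 2 * r * w.2 & r * w.2 < w.1]
   then w.1^-1 * (p x * q x) * (p w.1 * q w.1) * (u x - u w.2) ^+ 2 else 0)%:E.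
pose h (w : measurableTypeR R * measurableTypeR R) : \bar R :=
  (if [&& 2 * r * M < w.1, w.1 < 2 * r * w.2 & r * w.2 < w.1] then
      w.1^-1 * (p w.1 * q w.1) * (u w.2 - u w.1) ^+ 2 else 0)%:E.
have mf : measurable_fun setT f by rewrite /f; prove_measurable.
have mh : measurable_fun setT h by rewrite /h; prove_measurable.
have f0 w : (0 <= f w)%E.
  rewrite /f lee_fin; case: ifP => // /andP[w1 _].
  by have ? := Mpos w1; prove_ge0.
have h0 w : (0 <= h w)%E.
  rewrite /h lee_fin; case: ifP => // /andP[w1 _].
  by have ? := Mpos w1; prove_ge0.
have mf1 y : measurable_fun setT (fun z => f (y, z)) by exact: measurableT_comp.
have mh1 y : measurable_fun setT (fun z => h (y, z)) by exact: measurableT_comp.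
have mF := @measurable_fun_fubini_tonelli_F _ _ _ _ _ mu f mf f0.
have mH := @measurable_fun_fubini_tonelli_F _ _ _ _ _ mu h mh h0.
have IF0 y : (0 <= \int[mu]_z f (y, z))%E by exact: integral_ge0.
have IH0 y : (0 <= \int[mu]_z h (y, z))%E by exact: integral_ge0.
have pq0 : 0 <= p x * q x by rewrite mulr_ge0.
have r40 : 0 <= 4 * r by rewrite mulr_ge0// ltW.
apply: (@le_trans _ _ (\int[mu]_y ((4 * r)%:E *
    (\int[mu]_z f (y, z) + (p x * q x)%:E * \int[mu]_z h (y, z))))%E); last first.
  rewrite ge0_integralZl_EFin//; last 2 first.
  - by move=> y _; rewrite adde_ge0// mule_ge0.
  - by apply: emeasurable_funD => //; exact: measurable_funeM.
  rewrite ge0_integralD//; last 2 first.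
  - by move=> y _; rewrite mule_ge0.
  - exact: measurable_funeM.
  rewrite ge0_integralZl_EFin//.
  apply: lee_wpmul2l => //; apply: leeD; first exact: le_integral_tail.
  by apply: lee_wpmul2l => //; exact: le_integral_mid.
apply: ge0_le_integral => //.
- by move=> y _; rewrite lee_fin; case: ifP.
- by prove_measurable.
- by apply: measurable_funeM; apply: emeasurable_funD => //; exact: measurable_funeM.
move=> y _; case: ifP => [/andP[My xy]|_]; last first.
  by rewrite mule_ge0// adde_ge0// mule_ge0.
have y0 := Mpos My.
have cE : 0 <= 2 * r * y^-1 * ent x y.
  by rewrite mulr_ge0// mulr_ge0 ?invr_ge0 ?(ltW y0)// mulr_ge0// ltW.
(* The left side does not depend on z, so it equals its average over (y/2r, y/r). *)
rewrite [leLHS](_ : _ = \int[mu]_z (if (y < 2 * r * z) && (r * z < y) then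
    2 * r * y^-1 * ent x y else 0)%:E)%E; last first.
  rewrite integral_indicator_lt_gt//; congr _%:E.
  by field; rewrite !gt_eqF.
rewrite -ge0_integralZl_EFin//.
rewrite -ge0_integralD//; last 2 first.
- by move=> z _; rewrite mule_ge0.
- exact: measurable_funeM.
have mS : measurable_fun setT (fun z => f (y, z) + (p x * q x)%:E * h (y, z))%E.
  by apply: emeasurable_funD => //; exact: measurable_funeM.
rewrite -ge0_integralZl_EFin//; last first.
  by move=> z _; rewrite adde_ge0// mule_ge0.
apply: ge0_le_integral => //.
- by move=> z _; rewrite lee_fin; case: ifP.
- by prove_measurable.
- exact: measurable_funeM.
move=> z _; rewrite /f /h/= My xy/=.
case: ifP => [/andP[yz zy]|_]; last by rewrite mule0 adde0 mule0.
rewrite -(EFinM (p x * q x)) -EFinD -EFinM lee_fin.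
rewrite [leLHS](_ : _ = 2 * r * y^-1 * (p x * q x * (p y * q y)) *
  (u x - u y) ^+ 2); last by ring.
rewrite [leRHS](_ : _ = 2 * r * y^-1 * (p x * q x * (p y * q y)) *
  (2 * ((u x - u z) ^+ 2 + (u z - u y) ^+ 2))); last by ring.
apply: ler_wpM2l.
  by rewrite mulr_ge0// ?mulr_ge0 ?invr_ge0// ltW.
(* With a = u(x) - u(z) and c = u(z) - u(y), (a + c)^2 <= 2 a^2 + 2 c^2 because (a - c)^2 >= 0. *)
have := sqr_ge0 (u x - u z - (u z - u y)); nra.
Qed.

(** * From all pairs to the variance *)

(** The term K comes from the near pairs, 4 r K^3 from [le_integral_tail] and 4 r K^2 from
    [le_integral_mid]. *)
Lemma le_integral_ordered_pairs :
  (\int[mu]_x \int[mu]_y (if x < y then ent x y else 0)%:E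
   <= (K + 4 * r * K ^+ 3 + 4 * r * K ^+ 2)%:E *
      \int[mu]_x \int[mu]_y (diss x y)%:E)%E.
Proof.
set D := (\int[mu]_x \int[mu]_y (diss x y)%:E)%E.
have D0 : (0 <= D)%E by exact: integral_ge0.
have K0 := ltW K_gt0.
have r40 : 0 <= 4 * r by rewrite mulr_ge0// ltW.
have k10 : 0 <= K + 4 * r * K ^+ 3 by rewrite addr_ge0// mulr_ge0// exprn_ge0.
have k20 : 0 <= 4 * r * K ^+ 2 by rewrite mulr_ge0// exprn_ge0.
have qp0 x : (0 <= (q x * p x)%:E)%E by rewrite lee_fin mulr_ge0.
have mqp : measurable_fun setT (fun x => (q x * p x)%:E) by prove_measurable.
(* This intermediate bound holds for each x before integration; its last term integrates to a
   multiple of [D] because nu has mass 1. *)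
apply: (@le_trans _ _ (\int[mu]_x ((K + 4 * r * K ^+ 3)%:E *
   (\int[mu]_y (diss x y)%:E) + ((4 * r * K ^+ 2)%:E * D) * (q x * p x)%:E))%E);
  last first.
  rewrite ge0_integralD//; last 4 first.
  - by move=> x _; rewrite mule_ge0.
  - exact: measurable_funeM.
  - by move=> x _; rewrite mule_ge0// mule_ge0.
  - exact: measurable_funeM.
  rewrite ge0_integralZl_EFin// ge0_integralZl//; last by rewrite mule_ge0.
  by rewrite qp_eq1 mule1 -ge0_muleDl.
pose e (z : measurableTypeR R * measurableTypeR R) : \bar R :=
  (if z.1 < z.2 then ent z.1 z.2 else 0)%:E.
have ment : measurable_fun setT e by rewrite /e; prove_measurable.
have e0 z : (0 <= e z)%E by rewrite /e lee_fin; case: ifP.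
apply: ge0_le_integral => //.
- by move=> x _; apply: integral_ge0 => y _; exact: (e0 (x, y)).
- exact: (@measurable_fun_fubini_tonelli_F _ _ _ _ _ mu e).
- by apply: emeasurable_funD; exact: measurable_funeM.
move=> x _; have [x0|x0] := leP x 0.
  rewrite integral0_eq; first by rewrite adde_ge0 ?mule_ge0.
  by move=> y _; rewrite p_eq0// !mul0r if_same.
have far0 y : (0 <= (if (2 * r * M < y) && (2 * r * x <= y)
    then ent x y else 0)%:E)%E by rewrite lee_fin; case: ifP.
have mfar : measurable_fun setT (fun y => (if (2 * r * M < y) && (2 * r * x <= y)
    then ent x y else 0)%:E) by prove_measurable.
apply: (@le_trans _ _ (\int[mu]_y (K%:E * (diss x y)%:E +
   (if (2 * r * M < y) && (2 * r * x <= y) then ent x y else 0)%:E))%E).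
  apply: ae_ge0_le_integral => //.
  - by move=> y _; exact: (e0 (x, y)).
  - exact: (measurableT_comp ment (pair1_measurable x)).
  - by move=> y _; rewrite adde_ge0// mule_ge0.
  - by apply: emeasurable_funD => //; apply: measurable_funeM; exact: diss_meas1.
  (* The bounds on b and phi leave out the null set y = 2rM. *)
  exists [set 2 * r * M]; split => //; first exact: lebesgue_measure_set1.
  move=> y /=; apply: contra_notP => yM _; rewrite -EFinM -EFinD lee_fin.
  case: ifP => [xy|_]; last first.
    by prove_ge0.
  (* If y < 2rx or y < 2rM, the pair is near and [near_le] applies; if y >= 2rx and y > 2rM, the far
     term is [ent] itself. *)
  have [yx|xy2] := ltP y (2 * r * x); last first.
    have [yM2|yM2|/yM//] := ltgtP y (2 * r * M); last first.
      by rewrite /= ler_wpDl// mulr_ge0.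
    rewrite /= addr0 [leLHS](_ : _ = (q x * p y) * (p x * q y * (u x - u y) ^+ 2)).
      rewrite [leRHS](_ : _ = (K * b y x) * (p x * q y * (u x - u y) ^+ 2)).
        by apply: ler_wpM2r; [prove_ge0|rewrite near_le ?yM2 ?orbT].
      by ring.
    by ring.
  rewrite andbF addr0 [leLHS](_ : _ = (q x * p y) * (p x * q y * (u x - u y) ^+ 2)).
    rewrite [leRHS](_ : _ = (K * b y x) * (p x * q y * (u x - u y) ^+ 2)).
      by apply: ler_wpM2r; [prove_ge0|rewrite near_le ?yx].
    by ring.
  by ring.
rewrite ge0_integralD//; last 2 first.
- by move=> y _; rewrite mule_ge0.
- by apply: measurable_funeM; exact: diss_meas1.
rewrite ge0_integralZl_EFin//; last exact: diss_meas1.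
apply: le_trans (leeD (lexx _) (le_integral_far x)) _.
have r0 := ltW r_gt0.
move: (\int[mu]_y (diss x y)%:E)%E (dissI_ge0 x) => I I0.
rewrite ge0_muleDr ?mule_ge0 ?lee_fin ?exprn_ge0 ?mulr_ge0//.
rewrite !muleA -!EFinM addeA -ge0_muleDl ?lee_fin ?mulr_ge0 ?exprn_ge0//.
rewrite -EFinD [X in (_ <= _ + X)%E]muleAC -EFinM.
rewrite (_ : 4 * r * (p x * q x) * K ^+ 2 = 4 * r * K ^+ 2 * (q x * p x))//.
by ring.
Qed.

(** Symmetrisation over x < y gives the factor 2; on the diagonal the squared difference
    vanishes. *)
Lemma le_integral_pairs :
  (\int[mu]_x \int[mu]_y (ent x y)%:E
   <= (2 * (K + 4 * r * K ^+ 3 + 4 * r * K ^+ 2))%:E *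
      \int[mu]_x \int[mu]_y (diss x y)%:E)%E.
Proof.
rewrite EFinM -muleA.
apply: le_trans (lee_wpmul2l _ le_integral_ordered_pairs) => //.
apply: (@le_integral_sym _ (measurableTypeR R) R mu
  (fun x y : R => x < y) (fun x y : R => ent x y)).
- by prove_measurable.
- by prove_measurable.
- by [].
- by move=> x y; ring.
- move=> x y; rewrite -!leNgt => yx xy.
  by rewrite (@le_anti _ _ x y) ?xy// subrr expr0n mulr0.
Qed.


(** For each x, [sqr_dist_mean_le] is applied with weight p q and a = u(x); integrating the result
    against p q in x gives the double integral of [ent]. *)
Lemma le_integral_variance :
  (forall x, 0 <= u x) -> (\int[mu]_x (p x * q x * u x)%:E = 1)%E ->
  (\int[mu]_x (p x * q x * (u x - 1) ^+ 2)%:E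
   <= (2 * (K + 4 * r * K ^+ 3 + 4 * r * K ^+ 2))%:E *
      \int[mu]_x \int[mu]_y (diss x y)%:E)%E.
Proof.
move=> u0 pqu1; apply: le_trans le_integral_pairs.
have ent0 x y : (0 <= (ent x y)%:E)%E by rewrite lee_fin.
have ment : measurable_fun setT
    (fun z : measurableTypeR R * measurableTypeR R => (ent z.1 z.2)%:E).
  by prove_measurable.
apply: ge0_le_integral => //.
- by move=> x _; rewrite lee_fin; prove_ge0.
- by prove_measurable.
- exact: (@measurable_fun_fubini_tonelli_F _ _ _ _ _ mu
    (fun z => (ent z.1 z.2)%:E)).
move=> x _.
have -> : (\int[mu]_y (ent x y)%:E =
    (p x * q x)%:E * \int[mu]_y (p y * q y * (u x - u y) ^+ 2)%:E)%E.
  rewrite -ge0_integralZl_EFin ?mulr_ge0//.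
  - by apply: eq_integral => y _; rewrite -EFinM; congr (_%:E); ring.
  - by move=> y _; rewrite lee_fin; prove_ge0.
  - by prove_measurable.
rewrite EFinM; apply: lee_wpmul2l; first by rewrite lee_fin mulr_ge0.
apply: sqr_dist_mean_le => //.
- by prove_measurable.
- by move=> y; rewrite mulr_ge0.
- by rewrite -qp_eq1; apply: eq_integral => y _; rewrite mulrC.
Qed.

End entropy_dissipation.

(** * Extension by zero *)

Lemma measurable_fun_mkif d (T : measurableType d) (R : realType) (c : T -> bool)
    (f : T -> R) :
  measurable_fun setT c -> measurable_fun [set x | c x] f ->
  measurable_fun setT (fun x => if c x then f x else 0).
Proof.
move=> mc mf; apply: measurable_fun_if => //.
by rewrite setTI; congr (measurable_fun _ f): mf; apply/seteqP; split.
Qed.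

Lemma integral_mkif d (T : measurableType d) (R : realType)
    (m : {measure set T -> \bar R}) (c : T -> bool) (f : T -> \bar R) :
  (\int[m]_(x in [set x | c x]) f x = \int[m]_x (if c x then f x else 0))%E.
Proof.
rewrite integral_mkcond; apply: eq_integral => x _; rewrite patchE.
case: ifPn => [/set_mem/= ->//|cx]; rewrite ifF//.
by apply/negP => h; move/negP: cx; apply; exact: mem_set.
Qed.

Lemma integral_EFin_mkif d (T : measurableType d) (R : realType)
    (m : {measure set T -> \bar R}) (c : T -> bool) (f : T -> R) :
  (\int[m]_(x in [set x | c x]) (f x)%:E =
   \int[m]_x (if c x then f x else 0)%:E)%E.
Proof. by rewrite integral_mkif; apply: eq_integral => x _; case: ifP. Qed.

(** * The inequality on the half-line *)

(** The bound on [zeta] is asked for beyond [r] or beyond [M], since [b_far] evaluates [zeta] at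
    every y > M, which may lie below [r]. *)
Theorem theorem2p4 (R : realType) (phi G : R -> R) (b : R -> R -> R)
    (K M r : R) (zeta : R -> R)
  (phi_meas : measurable_fun (`]0, +oo[ : set R) phi)
  (G_meas : measurable_fun (`]0, +oo[ : set R) G)
  (phi_ge0 : forall x, 0 < x -> 0 <= phi x)
  (Gphi1 : (\int[@lebesgue_measure R]_(x in `]0%R, +oo[) (G x * phi x)%:E = 1)%E)
  (b_meas : measurable_fun [set p : measurableTypeR R * measurableTypeR R | 0 < p.2 < p.1]
              (fun p : R * R => b p.1 p.2))
  (b_ge0 : forall y x, 0 < x < y -> 0 <= b y x)
  (K_gt0 : 0 < K) (M_gt0 : 0 < M) (r_gt1 : 1 < r)
  (zeta_ge1 : forall y, r < y \/ M < y -> 1 <= zeta y)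
  (G_bounded : forall x, 0 < x -> 0 <= G x <= K)
  (G_tail : forall x, M < x ->
     (\int[@lebesgue_measure R]_(y in `](r * x)%R, +oo[) (G y * phi y)%:E
        <= (K * G x)%:E)%E)
  (phi_growth : forall y z, 0 < z ->
     Num.max (2 * r * M) (r * z) < y < 2 * r * z ->
     (zeta y)^-1 * phi y <= K * phi z)
  (b_near : forall x y, 0 < x -> x < y < Num.max (2 * r * x) (2 * r * M) ->
     G x * phi y <= K * b y x)
  (b_far : forall x y, M < y -> 0 < x < y -> zeta y * y^-1 <= K * b y x) :
  exists2 C : R, 0 < C &
    forall g : R -> R,
      measurable_fun (`]0, +oo[ : set R) g ->
      (forall x, 0 < x -> 0 <= g x) ->
      (\int[@lebesgue_measure R]_(x in `]0%R, +oo[) (g x * phi x)%:E = 1)%E ->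
      reldens_defined phi g G ->
      (H2 phi g G <= C%:E * Db phi b g G)%E.
Proof.
have posE := set_itvoy (0 : R).
have mpos : measurable_fun setT (fun x : R => 0 < x) by prove_measurable.
rewrite posE in phi_meas G_meas Gphi1.
(* The constant of [le_integral_variance], fixed before [g] is introduced. *)
set D := 2 * (K + 4 * r * K ^+ 3 + 4 * r * K ^+ 2).
have r_gt0 : 0 < r by exact: lt_trans r_gt1.
exists D; first by rewrite /D mulr_gt0// !addr_gt0// !mulr_gt0// exprn_gt0.
move=> g mg g0 gphi1 ac.
rewrite posE in mg gphi1.
(* All data are extended by 0; [b0] also vanishes outside 0 < x < y, which turns the region of
   integration of [Db] into the whole plane. *)
pose p x := if 0 < x then phi x else 0.
pose q x := if 0 < x then G x else 0.
pose u x := if 0 < x then reldens g G x else 0.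
pose b0 y x := if 0 < x < y then b y x else 0.
have mp : measurable_fun setT p by exact: measurable_fun_mkif.
have mq : measurable_fun setT q by exact: measurable_fun_mkif.
have mu : measurable_fun setT u.
  apply: measurable_fun_mkif => //; apply: measurable_funM => //.
  exact: (measurableT_comp (@measurable_invr R) G_meas).
have mb : measurable_fun setT
    (fun z : measurableTypeR R * measurableTypeR R => b0 z.1 z.2).
  apply: (@measurable_fun_mkif _ _ _ (fun z : measurableTypeR R * measurableTypeR R =>
    0 < z.2 < z.1) (fun z => b z.1 z.2)) => //.
  by prove_measurable.
have p0 x : 0 <= p x by rewrite /p; case: ifP => // /phi_ge0.
have q0 x : 0 <= q x by rewrite /q; case: ifP => // /G_bounded/andP[].
have u0 x : 0 <= u x.
  by rewrite /u; case: ifP => // x0; rewrite divr_ge0 ?g0//; case/andP: (G_bounded _ x0).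
have b00 y x : 0 <= b0 y x by rewrite /b0; case: ifP => // /b_ge0.
have pN x : x <= 0 -> p x = 0 by rewrite /p leNgt => /negbTE ->.
have qp1 : (\int[@lebesgue_measure R]_x (q x * p x)%:E = 1)%E.
  rewrite -Gphi1 integral_EFin_mkif; apply: eq_integral => x _.
  by rewrite /p/q; case: ifP; rewrite ?mulr0.
have qK x : q x <= K.
  by rewrite /q; case: ifP => [/G_bounded/andP[]//|_]; exact: ltW.
have tail x : M < x ->
  (\int[@lebesgue_measure R]_y (if r * x < y then q y * p y else 0)%:E
     <= (K * q x)%:E)%E.
  move=> Mx; have x0 : 0 < x by exact: lt_trans Mx.
  have := G_tail _ Mx; rewrite /q x0.
  rewrite set_itvoy integral_EFin_mkif; congr (_ <= _)%E; apply: eq_integral => y _.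
  case: ifP => // xy; have y0 : 0 < y by apply: lt_trans xy; rewrite mulr_gt0.
  by rewrite /p y0.
have near x y : 0 < x -> x < y ->
  (y < 2 * r * x) || (y < 2 * r * M) -> q x * p y <= K * b0 y x.
  move=> x0 xy h; rewrite /q/p/b0 x0 xy (lt_trans x0 xy)/=.
  by apply: b_near => //; rewrite xy lt_max.
have far x y : M < y -> 0 < x < y -> y^-1 <= K * b0 y x.
  move=> My xy; rewrite /b0 xy; apply: le_trans (b_far _ _ My xy).
  (* As zeta(y) >= 1, dropping it only weakens [b_far]. *)
  rewrite ler_peMl// ?zeta_ge1//; last by right.
  by rewrite invr_ge0 ltW// (lt_trans M_gt0).
have mid y z : 0 < z -> 2 * r * M < y -> r * z < y < 2 * r * z ->
  y^-1 * p y <= K ^+ 2 * (p z * b0 y z).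
  move=> z0 My /andP[zy yz].
  have My' : M < y by rewrite (le_lt_trans _ My)// ler_peMl ?ltW//; lra.
  have y0 : 0 < y by exact: lt_trans My'.
  have zy' : z < y by rewrite (le_lt_trans _ zy)// ler_peMl ?ltW.
  rewrite /p/b0 z0 y0 zy'/=.
  have ze1 : 1 <= zeta y by apply: zeta_ge1; right.
  have ze0 : 0 < zeta y by exact: lt_le_trans ze1.
  have h1 : (zeta y)^-1 * phi y <= K * phi z.
    by apply: phi_growth => //; rewrite gt_max My zy.
  have h2 : zeta y * y^-1 <= K * b y z by apply: b_far => //; rewrite z0.
  (* The factor zeta(y) cancels in the product of the growth bound on [phi] and the lower bound on
     [b]. *)
  rewrite [leLHS](_ : _ = ((zeta y)^-1 * phi y) * (zeta y * y^-1)); last first.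
    by field; rewrite !gt_eqF.
  rewrite [leRHS](_ : _ = (K * phi z) * (K * b y z)); last by ring.
  by rewrite ler_pM// mulr_ge0 ?invr_ge0 ?phi_ge0// ltW.
(* Where G(x) = 0 the convention x / 0 = 0 makes the left integrand 0, and absolute continuity makes
   g(x) phi(x) = 0 almost everywhere there. Hence u has mean exactly 1 under nu, so that no mass of
   g phi is lost. *)
have pqu1 : (\int[@lebesgue_measure R]_x (p x * q x * u x)%:E = 1)%E.
  rewrite -gphi1 integral_EFin_mkif; apply: ge0_ae_eq_integral => //.
  - by prove_measurable.
  - apply/measurable_EFinP; apply: measurable_fun_mkif => //.
    exact: measurable_funM.
  - by move=> x _; rewrite lee_fin !mulr_ge0.
  - by move=> x _; rewrite lee_fin; case: ifP => // x0; rewrite mulr_ge0 ?g0 ?phi_ge0.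
  case: ac => N [mN N0 acN]; exists N; split => // x /= nx; apply: acN => acx.
  apply: nx => _; congr (_%:E).
  rewrite /p/q/u /reldens; case: ifP => x0; last by rewrite !mulr0.
  have [Gx|Gx] := eqVneq (G x) 0; first by rewrite Gx acx// mulr0 mul0r.
  by field.
have H2E : H2 phi g G =
    (\int[@lebesgue_measure R]_x (p x * q x * (u x - 1) ^+ 2)%:E)%E.
  rewrite /H2 posE integral_EFin_mkif; apply: eq_integral => x _.
  by rewrite /p/q/u; case: ifP => _; rewrite ?mul0r.
have DbE : Db phi b g G = (\int[@lebesgue_measure R]_x \int[@lebesgue_measure R]_y
    (p x * q y * b0 y x * (u x - u y) ^+ 2)%:E)%E.
  rewrite /Db posE integral_mkif; apply: eq_integral => x _.
  case: ifP => x0; last first.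
    by rewrite integral0_eq// => y _; rewrite /p x0 !mul0r.
  rewrite set_itvoy integral_EFin_mkif; apply: eq_integral => y _.
  rewrite /p/q/b0/u x0/=; case: ifP => xy; last by rewrite mulr0 mul0r.
  by rewrite (lt_trans x0 xy).
rewrite H2E DbE.
exact: (@le_integral_variance R p q u b0 K M r).
Qed.
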